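(* Let $R$ be a commutative ring with identity and let $M$ be a Noetherian flat $R$-module. Let $N$ be a proper submodule of $M$ generated by $n$ elements $x_1,\ldots,x_n\in M$. Then $\operatorname{s-ht}_R N\leq n$.
   Context: All rings are commutative with identity and all modules are unitary. For a submodule $N$ of an $R$-module $M$, $(N:M)=\{r\in R\mid rM\subseteq N\}$, and for $x\in M$ put $I_x^N=(N+Rx:M)=\{r\in R\mid rM\subseteq N+Rx\}$. A proper submodule $P$ of $M$ is called strongly prime if, for all $x,y\in M$, $I_x^P y\subseteq P$ implies $x\in P$ or $y\in P$. The set of all strongly prime submodules of $M$ is denoted $\operatorname{S-Spec}_R(M)$. A strongly prime submodule $P$ of $M$ is called strongly minimal prime over a submodule $N$ of $M$ if $N\subseteq P$ and there is no strongly prime submodule $L$ of $M$ with $N\subseteq L\subsetneq P$. For a strongly prime submodule $P$ of $M$, the strong height of $P$ is $\operatorname{s-ht}_R P=\sup\{n\mid \exists\, P_0,P_1,\ldots,P_n\in \operatorname{S-Spec}_R(M) \text{ such that } P_0\subsetneq P_1\subsetneq\cdots\subsetneq P_n=P\}$. For a proper submodule $N$ of $M$, the strong height of $N$ is $\operatorname{s-ht}_R N=\min\{\operatorname{s-ht}_R P\mid P\in\operatorname{S-Spec}_R(M),\ P \text{ is strongly minimal prime over } N\}$. *)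

(* Defs.v *)
From HB Require Import structures.
From mathcomp Require Import all_boot all_order all_algebra generic_quotient.
From mathcomp Require Import boolp classical_sets constructive_ereal.
Set Implicit Arguments.
Unset Strict Implicit.
Unset Printing Implicit Defensive.
Import GRing.Theory.

Local Open Scope classical_set_scope.
Local Open Scope quotient_scope.
Local Open Scope ring_scope.

(* A list of pairs [:: (a_1, m_1); ...; (a_k, m_k)] stands for the formal sum
   of the a_i (x) m_i.  No coefficients are needed, as r (a (x) m) is
   (r a) (x) m, and no formal opposites, as - (a (x) m) is (- a) (x) m. *)
Section TensorProduct.
Variables (R : comPzRingType) (A M : lmodType R).

Inductive tens_eq : seq (A * M) -> seq (A * M) -> Prop :=
| tens_eq_refl s : tens_eq s s
| tens_eq_sym s t : tens_eq s t -> tens_eq t s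
| tens_eq_trans t s u : tens_eq s t -> tens_eq t u -> tens_eq s u
| tens_eq_cat s s' t t' :
    tens_eq s s' -> tens_eq t t' -> tens_eq (s ++ t) (s' ++ t')
| tens_eqC s t : tens_eq (s ++ t) (t ++ s)
| tens_eq0 m : tens_eq [:: (0, m)] [::]
| tens_eqDl a b m : tens_eq [:: (a + b, m)] [:: (a, m); (b, m)]
| tens_eqDr a m p : tens_eq [:: (a, m + p)] [:: (a, m); (a, p)]
| tens_eqZ (r : R) a m : tens_eq [:: (r *: a, m)] [:: (a, r *: m)].

Definition tens_eqb (s t : seq (A * M)) : bool := `[< tens_eq s t >].

Lemma tens_eqb_equiv : equiv_class_of tens_eqb.
Proof.
split=> [s|s t|t s u]; first exact/asboolP/tens_eq_refl.
  by apply/asboolP/asboolP => /tens_eq_sym.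
by move=> /asboolP st /asboolP tu; exact/asboolP/(tens_eq_trans st tu).
Qed.

Canonical tens_equiv := EquivRelPack tens_eqb_equiv.

Definition tensor := {eq_quot tens_equiv}.
HB.instance Definition _ := Choice.on tensor.
HB.instance Definition _ := EqQuotient.on tensor.

Implicit Types (s t : seq (A * M)) (x y z : tensor) (a b : A) (m p : M).

Lemma tensorP s t : tens_eq s t <-> \pi_tensor s = \pi_tensor t.
Proof.
by split=> [st|/eqquotP/asboolP//]; apply/eqquotP/asboolP.
Qed.

Lemma tensor_repr s : tens_eq (repr (\pi_tensor s)) s.
Proof. by apply/tensorP; rewrite reprK. Qed.

Lemma tensorW (Q : tensor -> Prop) :
  (forall s, Q (\pi_tensor s)) -> forall x, Q x.
Proof. by move=> Qpi; elim/quotW. Qed.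

Definition pure a m : tensor := \pi_tensor [:: (a, m)].

Definition tens_zero : tensor := \pi_tensor [::].
Definition tens_add x y : tensor := \pi_tensor (repr x ++ repr y).

Definition tens_scale_seq (r : R) s := [seq (r *: q.1, q.2) | q <- s].
Definition tens_scale (r : R) x : tensor := \pi_tensor (tens_scale_seq r (repr x)).
Definition tens_opp x : tensor := tens_scale (- 1) x.

Lemma tens_eq_scale r s t :
  tens_eq s t -> tens_eq (tens_scale_seq r s) (tens_scale_seq r t).
Proof.
elim=> {s t} /=.
- by move=> s; exact: tens_eq_refl.
- by move=> s t _; exact: tens_eq_sym.
- by move=> t s u _ st _; exact: tens_eq_trans.
- by move=> s s' t t' _ ss _ tt; rewrite /tens_scale_seq !map_cat;
    exact: tens_eq_cat.
- by move=> s t; rewrite /tens_scale_seq !map_cat; exact: tens_eqC.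
- by move=> m; rewrite scaler0; exact: tens_eq0.
- by move=> a b m; rewrite scalerDr; exact: tens_eqDl.
- by move=> a m p; exact: tens_eqDr.
- by move=> q a m; rewrite scalerA mulrC -scalerA; exact: tens_eqZ.
Qed.

Lemma tens_addE s t :
  tens_add (\pi_tensor s) (\pi_tensor t) = \pi_tensor (s ++ t).
Proof. by apply/tensorP/tens_eq_cat; exact: tensor_repr. Qed.

Lemma tens_scaleE r s :
  tens_scale r (\pi_tensor s) = \pi_tensor (tens_scale_seq r s).
Proof. by apply/tensorP/tens_eq_scale; exact: tensor_repr. Qed.

Lemma tens_addA : associative tens_add.
Proof.
elim/tensorW=> s; elim/tensorW=> t; elim/tensorW=> u.
rewrite (tens_addE t u) (tens_addE s t) (tens_addE s (t ++ u)).
by rewrite (tens_addE (s ++ t) u) catA.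
Qed.

Lemma tens_addC : commutative tens_add.
Proof.
elim/tensorW=> s; elim/tensorW=> t.
by rewrite (tens_addE s t) (tens_addE t s); apply/tensorP/tens_eqC.
Qed.

Lemma tens_add0 : left_id tens_zero tens_add.
Proof. by elim/tensorW=> s; exact: (tens_addE [::] s). Qed.

Lemma tens_scaleDl_seq q r s :
  tens_eq (tens_scale_seq (q + r) s) (tens_scale_seq q s ++ tens_scale_seq r s).
Proof.
elim: s => [|[a m] s IHs] /=; first exact: tens_eq_refl.
rewrite scalerDl -cat1s -[X in tens_eq _ X]cat1s.
apply: (tens_eq_trans (tens_eq_cat (tens_eqDl _ _ _) IHs)).
rewrite -[[:: _; _]]cat1s -[(r *: a, m) :: tens_scale_seq r s]cat1s -catA.
apply: (tens_eq_cat (tens_eq_refl _)); rewrite !catA.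
by apply: (tens_eq_cat _ (tens_eq_refl _)); exact: tens_eqC.
Qed.

Lemma tens_scale0_seq s : tens_eq (tens_scale_seq 0 s) [::].
Proof.
elim: s => [|[a m] s IHs] /=; first exact: tens_eq_refl.
by rewrite scale0r -cat1s; exact: (tens_eq_cat (tens_eq0 m) IHs).
Qed.

Lemma tens_scaleA q r x :
  tens_scale q (tens_scale r x) = tens_scale (q * r) x.
Proof.
elim/tensorW: x => s.
rewrite (tens_scaleE r s) (tens_scaleE q (tens_scale_seq r s)).
rewrite (tens_scaleE (q * r) s) /tens_scale_seq -map_comp.
by congr (\pi_tensor _); apply: eq_map => -[a m] /=; rewrite scalerA.
Qed.

Lemma tens_scale1 : left_id 1 tens_scale.
Proof.
elim/tensorW=> s; rewrite tens_scaleE /tens_scale_seq; congr (\pi_tensor _).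
by rewrite -[RHS]map_id; apply: eq_map => -[a m] /=; rewrite scale1r.
Qed.

Lemma tens_scaleDr : right_distributive tens_scale tens_add.
Proof.
move=> r; elim/tensorW=> s; elim/tensorW=> t.
rewrite (tens_addE s t) (tens_scaleE r (s ++ t)) (tens_scaleE r s).
rewrite (tens_scaleE r t) (tens_addE (tens_scale_seq r s)).
by rewrite /tens_scale_seq map_cat.
Qed.

Lemma tens_scaleDl x : {morph tens_scale^~ x : q r / q + r >-> tens_add q r}.
Proof.
move=> q r; elim/tensorW: x => s; rewrite (tens_scaleE (q + r) s) (tens_scaleE q s).
rewrite (tens_scaleE r s) (tens_addE (tens_scale_seq q s)).
exact/tensorP/tens_scaleDl_seq.
Qed.

Lemma tens_addN : left_inverse tens_zero tens_opp tens_add.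
Proof.
move=> x; rewrite /tens_opp -[X in tens_add _ X]tens_scale1 -tens_scaleDl.
rewrite addNr; elim/tensorW: x => s; rewrite (tens_scaleE 0 s).
exact/tensorP/tens_scale0_seq.
Qed.

HB.instance Definition _ :=
  GRing.isZmodule.Build tensor tens_addA tens_addC tens_add0 tens_addN.
HB.instance Definition _ :=
  GRing.Zmodule_isLmodule.Build R tensor
    tens_scaleA tens_scale1 tens_scaleDr tens_scaleDl.

Lemma pureDl a b m : pure (a + b) m = pure a m + pure b m.
Proof.
by rewrite [RHS](tens_addE [:: (a, m)] [:: (b, m)]); apply/tensorP/tens_eqDl.
Qed.

Lemma pureDr a m p : pure a (m + p) = pure a m + pure a p.
Proof.
by rewrite [RHS](tens_addE [:: (a, m)] [:: (a, p)]); apply/tensorP/tens_eqDr.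
Qed.

Lemma pureZl r a m : pure (r *: a) m = r *: pure a m.
Proof. by rewrite [RHS](tens_scaleE r [:: (a, m)]). Qed.

Lemma pureZr r a m : pure a (r *: m) = r *: pure a m.
Proof. by rewrite -pureZl; apply/esym/tensorP/tens_eqZ. Qed.

Lemma pi_tensorE s : \pi_tensor s = \sum_(q <- s) pure q.1 q.2.
Proof.
elim: s => [|[a m] s IHs]; first by rewrite big_nil.
by rewrite big_cons -IHs /= -cat1s -(tens_addE [:: (a, m)] s).
Qed.

Lemma tensorE x : x = \sum_(q <- repr x) pure q.1 q.2.
Proof. by rewrite -pi_tensorE reprK. Qed.

Lemma tensor_lift (V : lmodType R) (h : A -> M -> V) :
    (forall m, linear (h^~ m)) -> (forall a, linear (h a)) ->
  exists g : {linear tensor -> V}, forall a m, g (pure a m) = h a m.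
Proof.
move=> hl hr.
have hD a b m : h (a + b) m = h a m + h b m.
  by rewrite -{1}[a]scale1r hl scale1r.
have h0 m : h 0 m = 0.
  by apply: (addrI (h 0 m)); rewrite -hD !addr0.
have hDr a m p : h a (m + p) = h a m + h a p.
  by rewrite -{1}[m]scale1r hr scale1r.
have h0r a : h a 0 = 0.
  by apply: (addrI (h a 0)); rewrite -hDr !addr0.
have hZ r a m : h (r *: a) m = r *: h a m by rewrite -[r *: a]addr0 hl h0 addr0.
have hZr r a m : h a (r *: m) = r *: h a m.
  by rewrite -[r *: m]addr0 hr h0r addr0.
pose g x := \sum_(q <- repr x) h q.1 q.2.
have gE s : g (\pi_tensor s) = \sum_(q <- s) h q.1 q.2.
  rewrite /g; move: (tensor_repr s); move: (repr _) => t; elim=> {s t} //=.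
  - by move=> t s u _ -> _ ->.
  - by move=> s s' t t' _ e1 _ e2; rewrite !big_cat /= e1 e2.
  - by move=> s t; rewrite !big_cat /= addrC.
  - by move=> m; rewrite big_seq1 big_nil.
  - by move=> a b m; rewrite !big_cons !big_nil !addr0 hD.
  - by move=> a m p; rewrite !big_cons !big_nil !addr0 hDr.
  - by move=> r a m; rewrite !big_seq1 hZ hZr.
have glin : linear g.
  move=> r; elim/tensorW=> s; elim/tensorW=> t.
  have -> : r *: \pi_tensor s + \pi_tensor t =
            \pi_tensor (tens_scale_seq r s ++ t).
    by rewrite [r *: _](tens_scaleE r s); exact: tens_addE.
  rewrite !gE big_cat big_map scaler_sumr; congr (_ + _).
  by apply: eq_bigr => q _; rewrite hZ.
pose gL := GRing.isLinear.Build R tensor V *:%R g glin.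
pose gT : {linear tensor -> V} := HB.pack g gL.
by exists gT => a m; rewrite /= gE big_seq1.
Qed.

Lemma eq_tensor (V : lmodType R) (g h : {linear tensor -> V}) :
  (forall a m, g (pure a m) = h (pure a m)) -> g =1 h.
Proof.
move=> gh x; rewrite [x]tensorE !linear_sum.
by apply: eq_bigr => q _; exact: gh.
Qed.

End TensorProduct.
Arguments pure {R A M} a m.

(* tensor_map f is f (x) id_M *)
Section TensorMap.
Variables (R : comPzRingType) (A B M : lmodType R) (f : {linear A -> B}).

Definition tensor_map (x : tensor A M) : tensor B M :=
  \sum_(q <- repr x) pure (f q.1) q.2.

Lemma tensor_map_lift :
  exists2 g : {linear tensor A M -> tensor B M},
    tensor_map =1 g & forall a m, g (pure a m) = pure (f a) m.
Proof.
have [g gE] := @tensor_lift R A M (tensor B M) (fun a m => pure (f a) m)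
  (fun m r a b => etrans (congr1 (pure^~ m) (linearP f r a b))
    (etrans (pureDl _ _ _) (congr1 (+%R^~ _) (pureZl _ _ _))))
  (fun a r m p => etrans (pureDr _ _ _) (congr1 (+%R^~ _) (pureZr _ _ _))).
exists g => // x; rewrite [in RHS](tensorE x) linear_sum.
by apply: eq_bigr => q _; rewrite gE.
Qed.

Lemma tensor_map_pure a m : tensor_map (pure a m) = pure (f a) m.
Proof. by have [g -> ->] := tensor_map_lift. Qed.

Lemma tensor_map_is_linear : linear tensor_map.
Proof. by have [g gE _] := tensor_map_lift => r x y; rewrite !gE linearP. Qed.

HB.instance Definition _ :=
  GRing.isLinear.Build R (tensor A M) (tensor B M) *:%R tensor_map
    tensor_map_is_linear.

End TensorMap.

Definition flat (R : comPzRingType) (M : lmodType R) : Prop :=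
  forall (A B : lmodType R) (f : {linear A -> B}),
    injective f -> injective (@tensor_map R A B M f).

Section StronglyPrime.
Variables (R : comPzRingType) (M : lmodType R).
Implicit Types (N L P : set M) (x y : M).

Definition submodule N : Prop := submod_closed (mem N).

Definition noetherian : Prop :=
  forall C : nat -> set M,
    (forall i, submodule (C i)) -> (forall i, C i `<=` C i.+1) ->
    exists k, forall i, (k <= i)%N -> C i = C k.

Definition generated (X : set M) : set M := smallest submodule X.

(* N + Rx *)
Definition add_cyclic N x : set M :=
  [set y + r *: x | y in N & r in [set: R]].

(* (N : M) *)
Definition colon N : set R := [set r | forall m : M, N (r *: m)].

(* I_x^N *)
Definition colon_cyclic N x : set R := colon (add_cyclic N x).

Definition strongly_prime P : Prop :=
  [/\ submodule P, P <> [set: M] &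
    forall x y, [set r *: y | r in colon_cyclic P x] `<=` P -> P x \/ P y].

Definition strongly_minimal_prime N P : Prop :=
  [/\ strongly_prime P, N `<=` P &
    ~ exists L, [/\ strongly_prime L, N `<=` L & L `<` P]].

(* the n for which some P_0 < P_1 < ... < P_n = P are all strongly prime *)
Definition chain_lengths P : set nat :=
  [set n | exists C : nat -> set M,
    [/\ forall i, (i <= n)%N -> strongly_prime (C i),
        forall i, (i < n)%N -> C i `<` C i.+1 & C n = P]].

(* Strong heights live in \bar int, a linear order containing
   {0, 1, 2, ...} u {+oo} in which every set of integers has a supremum. *)
Definition strong_height P : \bar int :=
  supremum -oo%E [set n%:Z%:E | n in chain_lengths P].

(* The heights being minimised are well ordered, so the infimum is a minimum
   as soon as N has a strongly minimal prime; otherwise it is +oo. *)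
Definition strong_height_sub N : \bar int :=
  infimum +oo%E [set strong_height P | P in strongly_minimal_prime N].

End StronglyPrime.

(* Main.v *)
From HB Require Import structures.
Require Import Defs.
From mathcomp Require Import all_boot all_order all_algebra ring.
From mathcomp Require Import boolp classical_sets constructive_ereal.
Set Implicit Arguments.
Unset Strict Implicit.
Unset Printing Implicit Defensive.
Import Order.TTheory GRing.Theory Num.Theory.
Local Open Scope classical_set_scope.
Local Open Scope ring_scope.

(* Strongly prime submodules are torsion-free of rank one modulo their colon
   ideal, so P |-> (P : M) maps strict chains of them to strict chains of primes
   containing ann M.  Let p be a minimal prime over (N : M).  A submodule P
   maximal among those containing N with (P : M) contained in p is strongly
   prime, has (P : M) = p, and is strongly minimal over N.  As M is flat, and
   finitely presented over R / ann M, it has a dual basis; combining its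
   functionals with the rank one quotient M / P gives phi : M -> R / ann M with
   phi(P) in p and phi(M) not in p.  Then p is minimal over ann M and the n
   elements phi(x_i), and Krull's height theorem bounds the chains below p. *)

(** * Ascending chain condition *)

(** Relative to a class [K], so as to cover both the submodules of [M] and the ideals of [R]
    containing [ann M]. *)
Definition acc (T : Type) (K : set T -> Prop) : Prop :=
  forall C : nat -> set T, (forall i, K (C i)) -> (forall i, C i `<=` C i.+1) ->
  exists k, forall i, (k <= i)%N -> C i = C k.

Lemma acc_max (T : Type) (K F : set T -> Prop) :
    acc K -> (forall X, F X -> K X) -> (exists X, F X) ->
  exists2 X, F X & forall Y, F Y -> X `<=` Y -> Y `<=` X.
Proof.
move=> accK FK [X0 FX0]; apply: contrapT => nomax.
have next X : exists Y, F X -> F Y /\ X `<` Y.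
  case: (pselect (F X)) => [FX|nFX]; last by exists X.
  apply: contrapT => noY; apply: nomax; exists X => // Y FY XY.
  by apply: contrapT => nYX; apply: noY; exists Y.
have [nx nxP] := choice next.
pose C i := iter i nx X0.
have FC i : F (C i) by elim: i => [//|i IHi] /=; case: (nxP _ IHi).
have CC i : C i `<` C i.+1 by case: (nxP _ (FC i)).
have [k kP] := accK C (fun i => FK _ (FC i)) (fun i => (CC i).1).
by have [_] := CC k; rewrite (kP k.+1 (leqnSn k)); apply.
Qed.

(** * Krull's height theorem *)

Section Ideals.
Variable R : comPzRingType.
Implicit Types (I p S : set R) (a b r x y z : R).

Definition ideal I : Prop :=
  [/\ I 0, forall a b, I a -> I b -> I (a + b) & forall r a, I a -> I (r * a)].

Definition prime_ideal p : Prop :=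
  [/\ ideal p, ~ p 1 & forall a b, p (a * b) -> p a \/ p b].

Definition add_gen I a : set R := [set z | exists i r, I i /\ z = i + r * a].

Definition minimal_prime I p : Prop :=
  [/\ prime_ideal p, I `<=` p &
    forall p', prime_ideal p' -> I `<=` p' -> p' `<=` p -> p `<=` p'].

Lemma ideal0 I : ideal I -> I 0. Proof. by case. Qed.
Lemma idealD I a b : ideal I -> I a -> I b -> I (a + b).
Proof. by case=> _ + _; apply. Qed.
Lemma idealMl I r a : ideal I -> I a -> I (r * a).
Proof. by case=> _ _; apply. Qed.
Lemma idealMr I r a : ideal I -> I a -> I (a * r).
Proof. by rewrite mulrC; exact: idealMl. Qed.
Lemma idealB I a b : ideal I -> I a -> I b -> I (a - b).
Proof.
by move=> Iid Ia Ib; rewrite -mulN1r; apply: idealD => //; exact: idealMl.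
Qed.


End Ideals.

Ltac mem_ideal :=
  first [ by []
        | apply: idealB; solve [mem_ideal] | apply: idealD; solve [mem_ideal]
        | apply: idealMl; solve [mem_ideal] | apply: idealMr; solve [mem_ideal] ].

Section PrimeIdeals.
Variable R : comPzRingType.
Implicit Types (I p S : set R) (a b : R).

Lemma primeM p a b : prime_ideal p -> ~ p a -> ~ p b -> ~ p (a * b).
Proof. by case=> _ _ pM na nb /pM[/na|/nb]. Qed.

Lemma primeX p a n : prime_ideal p -> p (a ^+ n) -> p a.
Proof.
case=> pI p1 pM; elim: n => [/p1//|n IHn]; rewrite exprS.
by case/pM.
Qed.

Lemma ideal_add_gen I a : ideal I -> ideal (add_gen I a).
Proof.
move=> Iid; split.
- by exists 0, 0; split; [exact: ideal0|rewrite mul0r addr0].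
- move=> _ _ [i [r [Ii ->]]] [j [s [Ij ->]]]; exists (i + j), (r + s).
  by split; [exact: idealD|ring].
- move=> t _ [i [r [Ii ->]]]; exists (t * i), (t * r).
  by split; [exact: idealMl|ring].
Qed.

Lemma sub_add_gen I a : I `<=` add_gen I a.
Proof. by move=> z Iz; exists z, 0; rewrite mul0r addr0. Qed.

Lemma mem_add_gen I a : ideal I -> add_gen I a a.
Proof. by move=> Iid; exists 0, 1; split; [exact: ideal0|ring]. Qed.

Lemma add_gen_sub I J a : ideal J -> I `<=` J -> J a -> add_gen I a `<=` J.
Proof. by move=> Jid IJ Ja _ [i [r [/IJ Ji ->]]]; mem_ideal. Qed.

(** If [a] and [b] are outside [I], both [I + Ra] and [I + Rb] meet [S]; when [a * b] is in [I], the
    product of two such elements of [S] falls into [I]. *)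
Lemma maximal_disjoint_prime I S :
    ideal I -> S 1 -> (forall a b, S a -> S b -> S (a * b)) ->
    (forall z, I z -> ~ S z) ->
    (forall J, ideal J -> I `<=` J -> (forall z, J z -> ~ S z) -> J `<=` I) ->
  prime_ideal I.
Proof.
move=> Iid S1 SM IS Imax; split=> [//|/IS//|a b Iab].
have meets c : ~ I c -> exists i r, I i /\ S (i + r * c).
  move=> nIc; apply: contrapT => no; apply/nIc/(Imax (add_gen I c)).
  - exact: ideal_add_gen.
  - exact: sub_add_gen.
  - by move=> _ [i [r [Ii ->]]] Sz; apply: no; exists i, r.
  - exact: mem_add_gen.
case: (pselect (I a)) => [|nIa]; [by left|right; apply: contrapT => nIb].
have [i [r [Ii Si]]] := meets _ nIa; have [j [s [Ij Sj]]] := meets _ nIb.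
apply: IS (SM _ _ Si Sj).
rewrite (_ : _ * _ = i * (j + s * b) + (r * a * j + r * s * (a * b))); last ring.
mem_ideal.
Qed.

End PrimeIdeals.


Section Krull.
Variables (R : comPzRingType) (A : set R).
(** In effect [R / A] is Noetherian; the arguments run on preimages in [R]. The case of interest is
    [A = ann M]. *)
Hypothesis accA : acc (fun I => ideal I /\ A `<=` I).
Implicit Types (B I J p q Q : set R).

Lemma exists_disjoint_prime I (S : set R) :
    ideal I -> A `<=` I -> S 1 -> (forall a b, S a -> S b -> S (a * b)) ->
    (forall z, I z -> ~ S z) ->
  exists p, [/\ prime_ideal p, I `<=` p & forall z, p z -> ~ S z].
Proof.
move=> Iid AI S1 SM IS.
have [|| p [pid Ip pS] pmax] := @acc_max _ _
  (fun J => [/\ ideal J, I `<=` J & forall z, J z -> ~ S z]) accA.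
- by move=> J [? IJ _]; split=> // z /AI/IJ.
- by exists I; split.
exists p; split=> //; apply: (maximal_disjoint_prime pid S1 SM pS) => J Jid pJ JS.
by apply: pmax => //; split=> // z /Ip/pJ.
Qed.

(* Minimal primes are the complements of the maximal multiplicative sets
   avoiding I. *)
Lemma exists_minimal_prime I :
  ideal I -> A `<=` I -> ~ I 1 -> exists p, minimal_prime I p.
Proof.
move=> Iid AI I1.
pose P : set (set R) := fun S =>
  (forall a b, S a -> S b -> S (a * b)) /\ (forall z, I z -> ~ S z).
have [F FP Ftot|S [[SM SI] Smax]] := @Zorn_bigcup _ P.
  split=> [a b [X FX Xa] [Y FY Yb]|z Iz [X FX]]; last exact: (FP _ FX).2.
  case: (Ftot X Y FX FY) => [/(_ _ Xa) Ya|/(_ _ Yb) Xb].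
    by exists Y => //; apply: (FP _ FY).1.
  by exists X => //; apply: (FP _ FX).1.
(* [P] must contain the empty union for Zorn's lemma, so it cannot demand [1]; maximality of [S]
   supplies it. *)
have PS1 : P (S `|` [set 1]).
  split=> [a b [Sa|->] [Sb|->]|z Iz [|ze]]; rewrite ?mulr1 ?mul1r.
  - by left; apply: SM.
  - by left.
  - by left.
  - by right.
  - exact: SI.
  - by apply: I1; rewrite -ze.
have S1 : S 1.
  apply: contrapT => nS1; apply: Smax PS1; split=> [|/(_ 1)]; first exact: subsetUl.
  by move=> h; apply/nS1/h; right.
have [p [pP Ip pS]] := exists_disjoint_prime Iid AI S1 SM SI.
exists p; split=> // p' p'P Ip' p'p z pz; apply: contrapT => np'z.
apply: (Smax (~` p')); last first.
  by split=> [a b|a /Ip' ?]; [exact: primeM|apply].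
split=> [a Sa /p'p/pS//|/(_ z np'z)]; exact: pS.
Qed.

(* R_p / B R_p is Artinian, stated for the preimages of its ideals in R. *)
Lemma minimal_prime_artinian B p : ideal B -> A `<=` B -> minimal_prime B p ->
  forall I, ideal I -> B `<=` I ->
  forall J : nat -> set R, (forall m, ideal (J m)) ->
    (forall m, J m.+1 `<=` J m) ->
  exists n, forall m, (n <= m)%N -> forall z, J n z ->
  exists s j, [/\ ~ p s, J m j & I (s * z - j)].
Proof.
move=> Bid AB [pP Bp pmin] I0 I0id BI0 J Jid Jdec.
have [pid p1 pM] := pP.
have Jle m n : (m <= n)%N -> J n `<=` J m.
  move=> /subnK <-; elim: (n - m)%N => [//|k IHk] z.
  by rewrite addSn => /Jdec/IHk.
pose stab I := exists n, forall m, (n <= m)%N -> forall z, J n z ->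
  exists s j, [/\ ~ p s, J m j & I (s * z - j)].
apply: contrapT => nstab0.
(* Noetherian induction: [I] is maximal among the ideals modulo which the chain does not stabilise
   locally at [p]. *)
have [||I [Iid BI nstab] Imax] := @acc_max _ _
  (fun I => [/\ ideal I, B `<=` I & ~ stab I]) accA.
- by move=> I [? BI _]; split=> // z /AB/BI.
- by exists I0; split.
have Ip : I `<=` p.
  move=> s Is; apply: contrapT => nps; apply: nstab; exists 0%N => m _ z _.
  exists s, 0; split=> //; first exact: ideal0.
  by rewrite subr0; exact: idealMr.
pose col a := [set r | exists2 s, ~ p s & I (s * (r * a))].
have colid a : ideal (col a).
  split.
  - by exists 1 => //; rewrite mul0r mulr0; exact: ideal0.
  - move=> r r' [s ps Is] [s' ps' Is']; exists (s * s'); first exact: primeM.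
    rewrite (_ : _ * _ = s' * (s * (r * a)) + s * (s' * (r' * a))); last ring.
    mem_ideal.
  - move=> t r [s ps Is]; exists s => //.
    by rewrite (_ : _ * _ = t * (s * (r * a))); [exact: idealMl|ring].
have Icol a : I `<=` col a.
  by move=> i Ii; exists 1 => //; rewrite mul1r; exact: idealMr.
(* A maximal proper annihilator of an element of R_p / I R_p is prime. *)
have [||_ [a na ->] amax] := @acc_max _ _
  (fun X => exists2 a, ~ col a 1 & X = col a) accA.
- by move=> _ [a _ ->]; split; [exact: colid|move=> z /AB/BI/Icol].
- by exists (col 1), 1 => // -[s ps]; rewrite !mulr1 => /Ip.
have colP : prime_ideal (col a).
  split=> [//|//|b c cbc].
  case: (pselect (col (c * a) 1)) => [[s ps Is]|nc].
    by right; exists s => //; rewrite mul1r in Is.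
  left; apply: (amax (col (c * a))); first by exists (c * a).
    move=> r [s ps Is]; exists s => //.
    by rewrite (_ : _ * _ = c * (s * (r * a))); [exact: idealMl|ring].
  by case: cbc => s ps Is; exists s => //; rewrite [b * _]mulrA.
have colp : col a `<=` p.
  move=> r [s ps Is]; apply: contrapT => nr; apply: na.
  by exists (s * r); [exact: primeM|rewrite mul1r -mulrA].
(* Minimality of [p] over [B] gives [col a = p]: modulo [I] and locally at [p], [a] spans a copy of
   the residue field. *)
have pcol : p `<=` col a by apply: pmin => // z /BI/Icol.
have [n1 n1P] : stab (add_gen I a).
  apply: contrapT => nst; apply: na; exists 1 => //; rewrite !mul1r.
  apply: (Imax (add_gen I a)); last exact: mem_add_gen; last exact: sub_add_gen.
  split=> //; first exact: ideal_add_gen.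
  by move=> z /BI; exact: sub_add_gen.
(* [E m]: locally, [a] lies in [J m + I]. If this always holds, the remainder [c * a] left by
   stability modulo [I + Ra] is absorbed into [J m]. If it fails at [m0], then [c] must lie in [p],
   so it kills [a] modulo [I] locally. *)
pose E m := exists s j, [/\ ~ p s, J m j & I (s * a - j)].
case: (pselect (forall m, E m)) => [Eall|/existsNP[m0 nE]].
  apply: nstab; exists n1 => m n1m z Jz.
  have [s [j [ps Jj [i [c [Ii e]]]]]] := n1P m n1m z Jz.
  have [s' [j' [ps' Jj' Ij']]] := Eall m.
  exists (s' * s), (s' * j + c * j'); split; first exact: primeM.
    mem_ideal.
  rewrite (_ : _ - _ = s' * (s * z - j) - c * j'); last ring.
  rewrite e (_ : _ - _ = s' * i + c * (s' * a - j')); last ring.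
  mem_ideal.
apply: nstab; exists (maxn n1 m0) => m; rewrite geq_max => /andP[n1m m0m] z Jz.
have Jn1z : J n1 z by apply: Jle Jz; exact: leq_maxl.
have Jm0z : J m0 z by apply: Jle Jz; exact: leq_maxr.
have [s [j [ps Jj [i [c [Ii e]]]]]] := n1P m n1m z Jn1z.
case: (pselect (p c)) => [/pcol[s' ps' Is']|nc].
  exists (s' * s), (s' * j); split; [exact: primeM|exact: idealMl|].
  rewrite (_ : _ - _ = s' * (s * z - j)); last ring.
  rewrite e mulrDr; apply: idealD => //; exact: idealMl.
case: nE; exists c, (s * z - j); split=> //.
  apply: idealB => //; first exact: idealMl.
  exact: Jle Jj.
by rewrite e (_ : _ - _ = - 1 * i); [exact: idealMl|ring].
Qed.

(** Krull's principal ideal theorem in the domain [R / Q]. For [y] in [q] outside [Q], the symbolic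
    powers of [y] stabilise modulo [x] locally at [p]; Nakayama removes [x], and cancelling [y ^+ n]
    makes a unit at [q] a multiple of [y]. *)
Lemma krull_principal Q q p (x : R) :
    prime_ideal Q -> A `<=` Q -> prime_ideal q -> Q `<` q -> q `<` p ->
  ~ minimal_prime (add_gen Q x) p.
Proof.
move=> QP AQ qP [Qq nqQ] [qp npq] minp.
have [pP Bp pmin] := minp; have [Qid Q1 QM] := QP.
have [qid q1 qM] := qP; have [pid p1 pM] := pP.
have Bid : ideal (add_gen Q x) by exact: ideal_add_gen.
have nqx : ~ q x.
  by move=> qx; apply: npq; exact: (pmin q qP (add_gen_sub qid Qq qx) qp).
have px : p x by apply/Bp/mem_add_gen.
have [y qy nQy] : exists2 y, q y & ~ Q y.
  by apply: contrapT => no; apply: nqQ => y qy; apply: contrapT => ?; apply: no; exists y.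
(* The n-th symbolic power of (y) at q, modulo Q. *)
pose J n := [set z | exists t c, ~ q t /\ Q (t * z - c * y ^+ n)].
have Jid n : ideal (J n).
  split.
  - by exists 1, 0; rewrite mulr0 mul0r subr0; split=> //; exact: ideal0.
  - move=> a b [t [c [qt Qa]]] [t' [c' [qt' Qb]]].
    exists (t * t'), (t' * c + t * c'); split; first exact: primeM.
    rewrite (_ : _ - _ = t' * (t * a - c * y ^+ n) + t * (t' * b - c' * y ^+ n)).
      mem_ideal.
    ring.
  - move=> r a [t [c [qt Qa]]]; exists t, (r * c); split=> //.
    rewrite (_ : _ - _ = r * (t * a - c * y ^+ n)); last ring.
    exact: idealMl.
have Jdec n : J n.+1 `<=` J n.
  by move=> z [t [c [qt Qz]]]; exists t, (c * y); rewrite -mulrA -exprS.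
have QJ n : Q `<=` J n.
  move=> z Qz; exists 1, 0; split=> //.
  by rewrite mul1r mul0r subr0.
have AB : A `<=` add_gen Q x by move=> z /AQ; exact: sub_add_gen.
have [n nP] := minimal_prime_artinian Bid AB minp Bid (@subset_refl _ _) Jid Jdec.
have step z : J n z -> exists s r, [/\ ~ p s, J n r & J n.+1 (s * z - r * x)].
  move=> Jz; have [s [j [ps Jj [w [r [Qw e]]]]]] := nP n.+1 (leqnSn n) z Jz.
  (* Since [x] is outside [q], it can be moved into the denominator [t]. *)
  have Jr : J n r.
    have : J n (r * x).
      have -> : r * x = s * z - j - w by rewrite e; ring.
      apply: idealB; [exact: Jid| |exact: QJ].
      by apply: idealB; [exact: Jid|exact: idealMl|exact: Jdec].
    move=> [t [c [qt Qt]]]; exists (t * x), c; split; first exact: primeM.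
    by rewrite -mulrA [x * r]mulrC.
  exists s, r; split=> //; have -> : s * z - r * x = j + w.
    by rewrite -[s * z](subrK j) e; ring.
  by apply: idealD => //; exact: QJ.
pose loc z := exists2 s, ~ p s & J n.+1 (s * z).
(* Nakayama: if z is not locally in J n.+1, then s z = r x modulo J n.+1 makes
   K z strictly smaller than K r. *)
pose K z := [set u | exists s c, ~ p s /\ J n.+1 (s * u - c * z)].
have Kid z : ideal (K z).
  split.
  - by exists 1, 0; rewrite mulr0 mul0r subr0; split=> //; exact: ideal0.
  - move=> a b [t [c [pt Qa]]] [t' [c' [pt' Qb]]].
    exists (t * t'), (t' * c + t * c'); split; first exact: primeM.
    rewrite (_ : _ - _ = t' * (t * a - c * z) + t * (t' * b - c' * z)); last ring.
    mem_ideal.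
  - move=> r a [t [c [pt Qa]]]; exists t, (r * c); split=> //.
    rewrite (_ : _ - _ = r * (t * a - c * z)); last ring.
    exact: idealMl.
have locJ z0 : J n z0 -> loc z0.
  move=> Jz0; apply: contrapT => nloc0.
  have [||_ [z [Jz nlz ->]] zmax] := @acc_max _ _
    (fun X => exists z, [/\ J n z, ~ loc z & X = K z]) accA.
  - move=> _ [w [_ _ ->]]; split=> // v /AQ/QJ Jv; exists 1, 0; split=> //.
    by rewrite mul1r mul0r subr0; apply: Jv.
  - by exists (K z0), z0.
  have [s [r [ps Jr Jsz]]] := step z Jz.
  have nlr : ~ loc r.
    move=> [s' ps' Js']; apply: nlz; exists (s' * s); first exact: primeM.
    rewrite (_ : _ * _ = s' * (s * z - r * x) + x * (s' * r)); last ring.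
    mem_ideal.
  have Kr : K r r.
    by exists 1, 1; rewrite subrr; split=> //; exact: ideal0.
  have [s' [c [ps' Jc]]] : K z r.
    apply: (zmax (K r)) => //; first by exists r.
    move=> u [t [c [pt Ju]]]; exists (s * t), (c * x); split; first exact: primeM.
    rewrite (_ : _ - _ = s * (t * u - c * z) + c * (s * z - r * x)); last ring.
    mem_ideal.
  (* From [s' r = c z] and [s z = r x] modulo [J n.+1], the factor [s s' - c x] kills [r]; it is
     outside [p] because [x] is in [p]. *)
  apply: nlr; exists (s * s' - c * x).
    move=> pd; apply: (primeM pP ps ps').
    by rewrite -(subrK (c * x) (s * s')); mem_ideal.
  rewrite (_ : _ * _ = s * (s' * r - c * z) + c * (s * z - r * x)); last ring.
  mem_ideal.
have [|s ps [t [c [qt Qt]]]] := locJ (y ^+ n).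
  by exists 1, 1; split=> //; rewrite subrr; exact: ideal0.
have : Q (y ^+ n * (t * s - c * y)).
  rewrite exprS in Qt.
  by rewrite (_ : _ * _ = t * (s * y ^+ n) - c * (y * y ^+ n)); last ring.
case/QM => [/(primeX QP)//|/Qq qd].
have nqs : ~ q s by move=> /qp.
apply: (primeM qP qt nqs); rewrite -(subrK (c * y) (t * s)).
mem_ideal.
Qed.

(** Otherwise the products [s * z ^+ n] with [s] outside [p] avoid [B], and so does some prime over
    [B]. That prime lies in [p] by the case [n = 0], hence equals [p], yet it misses [z]. *)
Lemma minimal_prime_radical B p z : ideal B -> A `<=` B -> minimal_prime B p ->
  p z -> exists s n, ~ p s /\ B (s * z ^+ n).
Proof.
move=> Bid AB [pP Bp pmin] pz; apply: contrapT => no.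
have [pid p1 pM] := pP.
have [||z' Bz' [s [n [ps ez]]]|p' [p'P Bp' p'S]] :=
    @exists_disjoint_prime B [set u | exists s n, ~ p s /\ u = s * z ^+ n] Bid AB.
- by exists 1, 0%N; rewrite mul1r.
- move=> _ _ [s [n [ps ->]]] [s' [n' [ps' ->]]].
  exists (s * s'), (n + n')%N; split; first exact: primeM.
  by rewrite exprD; ring.
- by apply: no; exists s, n; rewrite -ez.
have p'p : p' `<=` p.
  move=> u p'u; apply: contrapT => npu; apply: (p'S u p'u).
  by exists u, 0%N; rewrite mulr1.
by apply: (p'S z (pmin _ p'P Bp' p'p z pz)); exists 1, 1%N; rewrite mul1r.
Qed.

(** Induction on [h]: pass to a prime [r] just below [p] and some [x1] of [xs] outside [r], and
    trade the other generators for as many elements of [r] over which [r] is minimal. *)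
Theorem krull_height (xs : seq R) p (q : nat -> set R) h :
    prime_ideal p -> A `<=` q 0%N ->
    (forall p', prime_ideal p' -> A `<=` p' -> (forall x, x \in xs -> p' x) ->
      p' `<=` p -> p `<=` p') ->
    (forall x, x \in xs -> p x) ->
    (forall i, (i <= h)%N -> prime_ideal (q i)) ->
    (forall i, (i < h)%N -> q i `<` q i.+1) -> q h = p ->
  (h <= size xs)%N.
Proof.
move=> + + + + + +; elim: h xs p q => [//|h IHh] xs p q pP Aq0 pmin xsp qP qlt qp.
have [pid p1 pM] := pP.
have Aqi i : (i <= h.+1)%N -> A `<=` q i.
  elim: i => [//|i IHi] ih z Az; apply: (qlt i ih).1; exact: IHi (ltnW ih) z Az.
have [||r [rP qhr rp] rmax] := @acc_max _ _
  (fun r => [/\ prime_ideal r, q h `<=` r & r `<` p]) accA.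
- by move=> r [[rid _ _] qr _]; split=> // z /(Aqi _ (leqnSn h))/qr.
- by exists (q h); split=> //; [exact: qP|rewrite -qp; exact: qlt].
have Ar : A `<=` r by move=> z /(Aqi _ (leqnSn h))/qhr.
have [rid r1 rM] := rP.
have [x1 x1xs nrx1] : exists2 x, x \in xs & ~ r x.
  apply: contrapT => no; apply: rp.2; apply: pmin => //; last exact: rp.1.
  by move=> x xxs; apply: contrapT => nrx; apply: no; exists x.
have minp : minimal_prime (add_gen r x1) p.
  split=> //; first exact: (add_gen_sub pid rp.1 (xsp x1 x1xs)).
  move=> p' p'P rp' p'p; apply: contrapT => npp'.
  apply: nrx1; apply: (rmax p'); last by apply/rp'/mem_add_gen.
    by split=> // z /qhr ?; apply/rp'/sub_add_gen.
  by move=> z rz; apply/rp'/sub_add_gen.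
(* Locally at [p], a power of each generator is an element [y] of [r] plus a multiple of [x1]; [0]
   is a dummy value for [x] outside [p]. *)
have rad x : exists y, p x -> r y /\
    exists s n a, ~ p s /\ s * x ^+ n = y + a * x1.
  case: (pselect (p x)) => [px|npx]; last by exists 0.
  have [||s [n [ps [y [a [ry e]]]]]] := minimal_prime_radical _ _ minp px.
  - exact: ideal_add_gen.
  - by move=> z /Ar; exact: sub_add_gen.
  - by exists y => _; split=> //; exists s, n, a.
have [f fP] := choice rad.
have sz := size_rem x1xs.
have xs0 : (0 < size xs)%N by case: (xs) x1xs.
rewrite -(prednK xs0) -sz ltnS -(size_map f).
(* The new chain replaces [q h] by the larger [r] and drops the top term [p]. *)
apply: (IHh _ r (fun i => if (i < h)%N then q i else r)) => //.
- by case: ifP.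
(* If [p'] were strictly below [r], then [p] would be minimal over [p' + R x1] with [r] strictly in
   between. *)
- move=> p' p'P Ap' ysp' p'r; apply: contrapT => nrp'.
  apply: (@krull_principal p' r p x1) => //.
  split=> //; first exact: (add_gen_sub pid (subset_trans p'r rp.1) (xsp x1 x1xs)).
  move=> p'' p''P p'p'' p''p; apply: pmin => //.
    by move=> z /Ap' p'z; apply/p'p''/sub_add_gen.
  have p''id : ideal p'' by case: p''P.
  have p''x1 : p'' x1 by apply/p'p''/mem_add_gen; case: p'P.
  move=> x xxs; case: (eqVneq x x1) => [->//|nx].
  have [rfx [s [n [a [ps e]]]]] := fP x (xsp x xxs).
  have : p'' (s * x ^+ n).
    rewrite e; apply: idealD => //; last exact: idealMl.
    apply/p'p''/sub_add_gen/ysp'/map_f.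
    by move: xxs; rewrite (perm_mem (perm_to_rem x1xs)) inE (negPf nx).
  by case: (p''P) => _ _ M /M[/p''p//|]; exact: primeX.
- move=> _ /mapP[x xr ->]; have xxs := mem_rem xr.
  by case: (fP x (xsp x xxs)).
- move=> i ih; case: ifP => // ih'; apply: qP; exact: leqW.
- move=> i ih; rewrite ih; case: ifP => [ih'|nih].
    by apply: qlt; exact: leqW.
  have ei : i.+1 = h by apply/eqP; rewrite eqn_leq ih leqNgt nih.
  have [qq nqq] := qlt i (leqW ih).
  rewrite ei in qq nqq; split=> [z /qq/qhr//|rq].
  by apply: nqq => z /qhr/rq.
- by rewrite ltnn.
Qed.

End Krull.

(** * Noetherian modules *)

Section Submodules.
Variables (R : comPzRingType) (M : lmodType R).
Implicit Types (N : set M) (u v : M).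

Lemma submoduleP N :
  submodule N <-> N 0 /\ forall a u v, N u -> N v -> N (a *: u + v).
Proof.
split=> -[N0 NP]; split=> [|a u v]; first exact: set_mem N0.
- by move=> /mem_set Nu /mem_set Nv; apply: set_mem (NP a u v Nu Nv).
- exact: mem_set N0.
- by move=> /set_mem Nu /set_mem Nv; apply: mem_set; exact: NP.
Qed.

Lemma submodule0 N : submodule N -> N 0. Proof. by case/submoduleP. Qed.
Lemma submoduleZ N a u : submodule N -> N u -> N (a *: u).
Proof. by case/submoduleP=> N0 NP Nu; rewrite -[_ *: _]addr0; exact: NP. Qed.
Lemma submoduleD N u v : submodule N -> N u -> N v -> N (u + v).
Proof. by case/submoduleP=> _ NP Nu Nv; rewrite -[u]scale1r; exact: NP. Qed.
Lemma submoduleB N u v : submodule N -> N u -> N v -> N (u - v).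
Proof.
by move=> Ns Nu Nv; rewrite -scaleN1r; apply: submoduleD => //; exact: submoduleZ.
Qed.
Lemma submodule_sum N (I : finType) (F : I -> M) :
  submodule N -> (forall i, N (F i)) -> N (\sum_i F i).
Proof.
move=> Ns NF; apply: big_ind => //; first exact: submodule0.
by move=> u v; exact: submoduleD.
Qed.

Lemma submoduleT : submodule [set: M].
Proof. by apply/submoduleP. Qed.

End Submodules.

(** Among the spans of finite families in [S] take a maximal one; adjoining [u] as a further
    generator cannot enlarge it. *)
Lemma noetherian_fg (R : comPzRingType) (V : lmodType R) (S : set V) :
    noetherian V -> submodule S ->
  exists k (v : 'I_k -> V), (forall i, S (v i)) /\
    forall u, S u -> exists c : 'I_k -> R, u = \sum_i c i *: v i.
Proof.
move=> noethV Ssub.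
pose span k (v : 'I_k -> V) := [set u | exists c, u = \sum_i c i *: v i].
have [||_ [k [v [Sv ->]]] vmax] := @acc_max _ (@submodule R V)
  (fun X => exists k (v : 'I_k -> V), (forall i, S (v i)) /\ X = span k v) noethV.
- move=> _ [k [v [Sv ->]]]; apply/submoduleP; split.
    by exists (fun=> 0); rewrite big1 // => i _; rewrite scale0r.
  move=> a _ _ [c ->] [d ->]; exists (fun i => a * c i + d i).
  rewrite scaler_sumr -big_split; apply: eq_bigr => i _ /=.
  by rewrite scalerDl scalerA.
- by exists (span _ (fun i : 'I_0 => 0)), 0%N, (fun=> 0); split=> // -[].
exists k, v; split=> // u Su.
pose v' (i : 'I_k.+1) := oapp v u (unlift ord0 i).
have v'0 : v' ord0 = u by rewrite /v' unlift_none.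
have v'S i : v' (lift ord0 i) = v i by rewrite /v' liftK.
apply: (vmax (span _ v')).
- exists k.+1, v'; split=> // i.
  by case: (unliftP ord0 i) => [j ->|->]; rewrite ?v'0 ?v'S.
- move=> _ [c ->]; exists (fun i => oapp c 0 (unlift ord0 i)).
  rewrite big_ord_recl unlift_none scale0r add0r.
  by apply: eq_bigr => i _; rewrite liftK v'S.
- exists (fun i => if i == ord0 then 1 else 0).
  rewrite big_ord_recl eqxx scale1r v'0 big1 ?addr0 // => i _.
  by rewrite scale0r.
Qed.

(** Induction on a list [s] of coordinates supporting the chain: the values at [t] stabilise in [M],
    the members vanishing at [t] stabilise by induction, and together they determine [C i]. *)
Lemma noetherian_ffun (R : comPzRingType) (M : lmodType R) (I : finType) :
  noetherian M -> noetherian {ffun I -> M}.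
Proof.
move=> noethM; have main (s : seq I) (C : nat -> set {ffun I -> M}) :
    (forall i, submodule (C i)) -> (forall i, C i `<=` C i.+1) ->
    (forall i f, C i f -> forall t, t \notin s -> f t = 0) ->
    exists k, forall i, (k <= i)%N -> C i = C k.
  elim: s C => [|t s IHs] C Csub Cinc Cs.
    exists 0%N => i _; apply/seteqP; split=> f Cf;
      (suff -> : f = 0 by exact: submodule0); apply/ffunP => t;
      by rewrite (Cs _ _ Cf) // ffunE.
  have Cle i j : (i <= j)%N -> C i `<=` C j.
    move=> /subnK <-; elim: (j - i)%N => [//|n IHn] f.
    by rewrite addSn => /IHn/Cinc.
  have [||k1 k1P] := noethM (fun i => [set f t | f in C i]).
  - move=> i; apply/submoduleP; split.
      by exists 0; [exact: submodule0|rewrite ffunE].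
    move=> a _ _ [f Cf <-] [g Cg <-]; exists (a *: f + g); last by rewrite !ffunE.
    by apply: submoduleD => //; exact: submoduleZ.
  - by move=> i _ [f Cf <-]; exists f => //; exact: Cinc.
  have [|||k2 k2P] := IHs (fun i => [set f | C i f /\
      forall t, t \notin s -> f t = 0]).
  - move=> i; apply/submoduleP; split.
      by split=> [|t' _]; [exact: submodule0|rewrite ffunE].
    move=> a f g [Cf f0] [Cg g0]; split.
      by apply: submoduleD => //; exact: submoduleZ.
    by move=> t' st'; rewrite !ffunE f0 // g0 // scaler0 addr0.
  - by move=> i f [/Cinc Cf f0].
  - by move=> i f [].
  exists (maxn k1 k2) => i; rewrite geq_max => /andP[k1i k2i].
  have k1m := leq_maxl k1 k2; have k2m := leq_maxr k1 k2.
  apply/seteqP; split; last by apply: Cle; rewrite geq_max k1i.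
  move=> f Cf.
  have [g Cg gt] : [set f t | f in C (maxn k1 k2)] (f t).
    by rewrite (k1P _ k1m) -(k1P _ k1i); exists f.
  have : (fun i => [set f | C i f /\ forall t, t \notin s -> f t = 0]) i (f - g).
    split.
      apply: submoduleB => //; apply: Cle Cg.
      by rewrite geq_max k1i.
    move=> t' st'; rewrite !ffunE; case: (eqVneq t' t) => [->|nt].
      by rewrite gt subrr.
    have st2 : t' \notin t :: s by rewrite inE negb_or nt.
    by rewrite (Cs _ _ Cf) // (Cs _ _ Cg) // subrr.
  rewrite (k2P _ k2i) -(k2P _ k2m) => -[Cfg _].
  by rewrite -(subrK g f); exact: submoduleD.
move=> C Csub Cinc; apply: (main (enum I)) => // i f _ t.
by rewrite mem_enum.
Qed.

Lemma ideal_colon (R : comPzRingType) (M : lmodType R) (N : set M) :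
  submodule N -> ideal (colon N).
Proof.
move=> Ns; split=> [m|a b Na Nb m|r a Na m].
- by rewrite scale0r; exact: submodule0.
- by rewrite scalerDl; exact: submoduleD.
- by rewrite -scalerA; exact: submoduleZ.
Qed.

(** Evaluation at generators of [M] embeds [R / ann M] in a finite power of [M]. *)
Lemma noetherian_acc_ideal (R : comPzRingType) (M : lmodType R) :
  noetherian M -> acc (fun I : set R => ideal I /\ colon [set 0 : M] `<=` I).
Proof.
move=> noethM C CP Cinc.
have [k [m [_ mP]]] := noetherian_fg noethM (@submoduleT R M).
pose ev r := [ffun b : 'I_k => r *: m b] : {ffun 'I_k -> M}.
have evB r s : ev r - ev s = ev (r - s).
  by apply/ffunP => b; rewrite !ffunE scalerBl.
have ev0 r : ev r = 0 -> colon [set 0 : M] r.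
  move=> /ffunP r0 u /=; have [c ->] := mP u I.
  rewrite scaler_sumr big1 // => b _.
  by have := r0 b; rewrite !ffunE scalerA mulrC -scalerA => ->; rewrite scaler0.
have [||K KP] := @noetherian_ffun R M 'I_k noethM (fun i => ev @` C i).
- move=> i; have [Cid _] := CP i; apply/submoduleP; split.
    exists 0; first exact: ideal0.
    by apply/ffunP => b; rewrite !ffunE scale0r.
  move=> a _ _ [r Cr <-] [s Cs <-]; exists (a * r + s); first by mem_ideal.
  by apply/ffunP => b; rewrite !ffunE scalerDl scalerA.
- by move=> i _ [r Cr <-]; exists r => //; exact: Cinc.
exists K => i Ki; apply/seteqP; split=> r Cr.
  have [s Cs es] : (ev @` C K) (ev r) by rewrite -(KP _ Ki); exists r.
  have [Cid AC] := CP K; rewrite -(subrK s r); apply: idealD => //.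
  by apply: AC; apply: ev0; rewrite -evB es subrr.
have [s Cs es] : (ev @` C i) (ev r) by rewrite (KP _ Ki); exists r.
have [Cid AC] := CP i; rewrite -(subrK s r); apply: idealD => //.
by apply: AC; apply: ev0; rewrite -evB es subrr.
Qed.

(** * Flatness and dual bases *)

Section Span.
Variables (R : comPzRingType) (W : lmodType R) (k : nat) (w : 'I_k -> W).

Definition in_span : pred W := fun u => `[< exists c, u = \sum_i c i *: w i >].

Fact in_span_submod_closed : submod_closed in_span.
Proof.
split=> [|a u v /asboolP[c ->] /asboolP[d ->]]; apply/asboolP.
  by exists (fun=> 0); rewrite big1 // => i _; rewrite scale0r.
exists (fun i => a * c i + d i).
rewrite scaler_sumr -big_split; apply: eq_bigr => i _ /=.
by rewrite scalerDl scalerA.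
Qed.
HB.instance Definition _ :=
  GRing.isSubmodClosed.Build R W in_span in_span_submod_closed.

(** Flatness concerns injections between modules, so the span is made a module whose inclusion is
    [val]. *)
Record span_type := Span { span_val : W; _ : in_span span_val }.
HB.instance Definition _ := [isSub for span_val].
HB.instance Definition _ := [Choice of span_type by <:].
HB.instance Definition _ := [SubChoice_isSubLmodule of span_type by <:].

End Span.

Section PureSums.
Variables (R : comPzRingType) (A M : lmodType R) (I : finType).

Lemma pure_suml (F : I -> A) (m : M) :
  pure (\sum_i F i) m = \sum_i pure (F i) m.
Proof.
apply: (big_morph (fun a => pure a m)) => [a b|]; first exact: pureDl.
by rewrite -(scale0r 0) pureZl scale0r.
Qed.

Lemma pure_sumr (a : A) (F : I -> M) :
  pure a (\sum_i F i) = \sum_i pure a (F i).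
Proof.
apply: (big_morph (pure a)) => [m p|]; first exact: pureDr.
by rewrite -(scale0r 0) pureZr scale0r.
Qed.

End PureSums.

Section FlatRelations.
Variables (R : comPzRingType) (M W : lmodType R) (k : nat).
Variables (w : 'I_k -> W).

(** The image in the [k]-th power of [M] of the tensor product of [M] with the module of relations
    among the [w i]. *)
Definition relation_span (f : 'I_k -> M) : Prop :=
  exists s : seq ({ffun 'I_k -> R} * M),
    all (fun q : {ffun _ -> R} * M => \sum_i q.1 i *: w i == 0) s /\
    forall i, f i = \sum_(q <- s) q.1 i *: q.2.

Lemma relation_spanD f g : relation_span f -> relation_span g ->
  relation_span (fun i => f i + g i).
Proof.
move=> [s [s0 sE]] [t [t0 tE]]; exists (s ++ t); split=> [|i].
  by rewrite all_cat s0.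
by rewrite big_cat sE tE.
Qed.

Lemma relation_spanN f : relation_span f -> relation_span (fun i => - f i).
Proof.
move=> [s [s0 sE]]; exists [seq (q.1, - q.2) | q <- s]; split=> [|i].
  by rewrite all_map.
by rewrite big_map sE -sumrN; apply: eq_bigr => q _; rewrite scalerN.
Qed.

Lemma relation_span1 (a : 'I_k -> R) (m : M) : \sum_i a i *: w i = 0 ->
  relation_span (fun i => a i *: m).
Proof.
move=> a0; exists [:: ([ffun i => a i], m)]; split=> [|i].
  by rewrite /= andbT; apply/eqP; rewrite -[RHS]a0; apply: eq_bigr => i _; rewrite ffunE.
by rewrite big_seq1 ffunE.
Qed.

Lemma relation_span0 : relation_span (fun=> 0).
Proof. by exists [::]; split=> // i; rewrite big_nil. Qed.

Lemma relation_span_ext f g : f =1 g -> relation_span f -> relation_span g.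
Proof. by move=> fg [s [s0 sE]]; exists s; split=> // i; rewrite -fg. Qed.

Lemma relation_span_sum (I : finType) (F : I -> 'I_k -> M) :
  (forall j, relation_span (F j)) -> relation_span (fun i => \sum_j F j i).
Proof.
move=> FP; elim: (index_enum I) => [|j r IHr].
  by apply: relation_span_ext relation_span0 => i; rewrite big_nil.
apply: relation_span_ext (relation_spanD (FP j) IHr) => i.
by rewrite big_cons.
Qed.

Lemma span_coord : exists c : span_type w -> 'I_k -> R,
  forall b, val b = \sum_i c b i *: w i.
Proof.
have [b|c cE] := @choice _ _ (fun (b : span_type w) c => val b = \sum_i c i *: w i).
  exact/asboolP/(valP b).
by exists c.
Qed.

Lemma span_gen : exists e : 'I_k -> span_type w, forall i, val (e i) = w i.
Proof.
have [i|e eE] := @choice _ _ (fun i (e : span_type w) => val e = w i); last by exists e.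
have wi : in_span w (w i).
  apply/asboolP; exists (fun j => (j == i)%:R).
  rewrite (bigD1 i) //= eqxx scale1r big1 ?addr0 // => j /negPf ->.
  by rewrite scale0r.
by exists (Span wi).
Qed.

(* Writing the elements of the span of w in coordinates turns equality of
   tensors into equality modulo relation_span. *)
Lemma flat_relation (m : 'I_k -> M) : flat M ->
    \sum_i pure (w i) (m i) = 0 ->
  exists l (a : 'I_l -> 'I_k -> R) (y : 'I_l -> M),
    (forall i, m i = \sum_j a j i *: y j) /\
    forall j, \sum_i a j i *: w i = 0.
Proof.
move=> flatM wm0; have [e eE] := span_gen; have [c cE] := span_coord.
have em0 : \sum_i pure (e i) (m i) = 0 :> tensor (span_type w) M.
  apply: (flatM _ _ (val : {linear span_type w -> W}) val_inj).
  rewrite linear0 linear_sum -[RHS]wm0; apply: eq_bigr => i _.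
  by rewrite [LHS]tensor_map_pure /= eE.
(* The coordinates [c] are merely chosen, not linear; their failures of linearity are relations
   among the [w i], which is why [ev] respects [tens_eq] modulo [relation_span]. *)
pose ev (s : seq (span_type w * M)) i := \sum_(q <- s) c q.1 i *: q.2.
have evP s t : tens_eq s t -> relation_span (fun i => ev s i - ev t i).
  elim=> {s t}.
  - by move=> s; apply: relation_span_ext relation_span0 => i; rewrite subrr.
  - move=> s t _ /relation_spanN; apply: relation_span_ext => i.
    by rewrite opprB.
  - move=> t s u _ ts _ su; apply: relation_span_ext (relation_spanD ts su) => i.
    by rewrite addrA subrK.
  - move=> s s' t t' _ ss _ tt; apply: relation_span_ext (relation_spanD ss tt) => i.
    by rewrite /ev !big_cat /= opprD addrACA.
  - move=> s t; apply: relation_span_ext relation_span0 => i.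
    by rewrite /ev !big_cat /= [X in _ - X]addrC subrr.
  - move=> u; have c0 : \sum_i c 0 i *: w i = 0 by rewrite -cE linear0.
    apply: relation_span_ext (relation_span1 u c0) => i.
    by rewrite /ev big_seq1 big_nil subr0.
  - move=> a b u.
    have cab : \sum_i (c (a + b) i - (c a i + c b i)) *: w i = 0.
      under eq_bigr => i _ do rewrite scalerBl scalerDl.
      by rewrite sumrB big_split /= -!cE linearD subrr.
    apply: relation_span_ext (relation_span1 u cab) => i.
    by rewrite /ev !big_cons !big_nil /= !addr0 scalerBl scalerDl.
  - move=> a u v; apply: relation_span_ext relation_span0 => i.
    by rewrite /ev !big_cons !big_nil /= !addr0 scalerDr subrr.
  - move=> r a u.
    have cra : \sum_i (c (r *: a) i - r * c a i) *: w i = 0.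
      under eq_bigr => i _ do rewrite scalerBl -scalerA.
      by rewrite sumrB -scaler_sumr -!cE linearZ subrr.
    apply: relation_span_ext (relation_span1 u cra) => i.
    by rewrite /ev !big_seq1 /= scalerBl mulrC scalerA.
have : relation_span (fun i => ev [seq (e i, m i) | i <- enum 'I_k] i - 0).
  have : tens_eq [seq (e i, m i) | i <- enum 'I_k] [::].
    apply/tensorP; rewrite pi_tensorE big_map big_enum /= em0.
    by rewrite pi_tensorE big_nil.
  by move=> /evP; apply: relation_span_ext => i; rewrite /ev big_nil.
(* The chosen coordinates of [e j] need not be the unit vector, but they differ from it by a
   relation. *)
have syz : relation_span (fun i => \sum_j ((i == j)%:R - c (e j) i) *: m j).
  apply: relation_span_sum => j; apply: relation_span1.
  under eq_bigr => i _ do rewrite scalerBl.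
  rewrite sumrB -cE eE (bigD1 j) //= eqxx scale1r big1 ?addr0 ?subrr // => i.
  by move=> /negPf ->; rewrite scale0r.
move=> /(relation_spanD syz) [s [s0 sE]].
exists (size s), (fun j i => (tnth (in_tuple s) j).1 i),
  (fun j => (tnth (in_tuple s) j).2).
split=> [i|j]; last first.
  by apply/eqP; exact: (allP s0 _ (mem_tnth j (in_tuple s))).
transitivity (\sum_(q <- s) q.1 i *: q.2); last by rewrite big_tnth.
rewrite -sE /ev big_map big_enum /=.
rewrite subr0 -big_split (bigD1 i) //= eqxx -scalerDl subrK scale1r big1 ?addr0 //.
move=> j; rewrite eq_sym => /negPf ->.
by rewrite -scalerDl sub0r addNr scale0r.
Qed.

End FlatRelations.

Section StronglyPrimeSubmodules.
Variables (R : comPzRingType) (M : lmodType R).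
Implicit Types (N P L : set M) (p : set R) (u v x y : M).

(** Encodes a linear map from [M] to [R / ann M] by a choice of representatives in [R]. *)
Definition linear_mod_ann (f : M -> R) : Prop :=
  forall a u v, colon [set 0 : M] (f (a *: u + v) - (a * f u + f v)).

Lemma submodule_0 : submodule [set 0 : M].
Proof. by apply/submoduleP; split=> // a u v -> ->; rewrite /= scaler0 addr0. Qed.

(** [flat_relation], applied to the matrix of relations among generators [m i], writes [m i] as the
    sum of the [a j i *: y j] with each row [a j] killing all relations modulo [ann M]; pairing
    coordinates with [a j] is then well defined modulo [ann M]. *)
Lemma flat_dual_basis : noetherian M -> flat M ->
  exists l (f : 'I_l -> M -> R) (y : 'I_l -> M),
    (forall u, u = \sum_j f j u *: y j) /\ forall j, linear_mod_ann (f j).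
Proof.
move=> noethM flatM.
have [k [m [_ mP]]] := noetherian_fg noethM (@submoduleT R M).
have [c cE] : exists c : M -> 'I_k -> R, forall u, u = \sum_i c u i *: m i.
  have [u|c cE] := @choice _ _ (fun u c => u = \sum_i c i *: m i); first exact: mP.
  by exists c.
(* The coefficients of a relation matter only modulo ann M, so its multiples by
   the generators, collected in tab, determine it: the relations form a
   submodule of a power of M, hence are finitely generated. *)
pose rel (r : 'I_k -> R) := \sum_i r i *: m i = 0.
pose tab (r : 'I_k -> R) := [ffun q => r q.1 *: m q.2] : {ffun 'I_k * 'I_k -> M}.
have [|l [g [gP gE]]] := @noetherian_fg R {ffun 'I_k * 'I_k -> M}
  [set tab r | r in rel] (noetherian_ffun noethM).
  apply/submoduleP; split.
    exists (fun=> 0); last by apply/ffunP => q; rewrite !ffunE scale0r.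
    by rewrite /rel big1 // => i _; rewrite scale0r.
  move=> a _ _ [r r0 <-] [s s0 <-]; exists (fun i => a * r i + s i); last first.
    by apply/ffunP => q; rewrite !ffunE scalerDl scalerA.
  rewrite /rel; under eq_bigr do rewrite scalerDl -scalerA.
  by rewrite big_split /= -scaler_sumr r0 s0 scaler0 addr0.
have [r rP] : exists r : 'I_l -> 'I_k -> R, forall t, rel (r t) /\ tab (r t) = g t.
  have [t|r rP] := @choice _ _ (fun t r => rel r /\ tab r = g t); last by exists r.
  by have [r r0 rg] := gP t; exists r.
(* Killing all w i amounts to killing the relations r t modulo ann M. *)
pose w i := [ffun q => r q.1 i *: m q.2] : {ffun 'I_l * 'I_k -> M}.
pose iota q u := [ffun q' => if q' == q then u else 0] : {ffun 'I_l * 'I_k -> M}.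
have wE i : w i = \sum_q r q.1 i *: iota q (m q.2).
  apply/ffunP => q; rewrite sum_ffunE (bigD1 q) //= !ffunE eqxx big1 ?addr0 //.
  by move=> q' /negPf nq; rewrite !ffunE eq_sym nq scaler0.
have [|l' [a [y [my aw]]]] := @flat_relation R M _ k w m flatM.
  (* Moving the scalars [r q.1 i] across the tensor leaves, for each [q], a pure tensor with the
     vanishing sum of the [r q.1 i *: m i]. *)
  under eq_bigr => i _ do rewrite wE pure_suml.
  rewrite exchange_big big1 //= => q _.
  under eq_bigr => i _ do rewrite pureZl -pureZr.
  have [r0 _] := rP q.1; rewrite -pure_sumr r0.
  by rewrite -(scale0r 0) pureZr scale0r.
have aann j (s : 'I_k -> R) : rel s -> colon [set 0 : M] (\sum_i s i * a j i).
  move=> s0.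
  have [d dE] : exists d, tab s = \sum_t d t *: g t by apply: gE; exists s.
  have sm i b : s i *: m b = \sum_t (d t * r t i) *: m b.
    have := congr1 (fun h : {ffun _ -> M} => h (i, b)) dE.
    rewrite ffunE /= => ->; rewrite sum_ffunE; apply: eq_bigr => t _.
    by have [_ <-] := rP t; rewrite !ffunE scalerA.
  have awb t b : \sum_i a j i *: (r t i *: m b) = 0.
    have := congr1 (fun h : {ffun _ -> M} => h (t, b)) (aw j).
    rewrite sum_ffunE ffunE => aw0; rewrite -[RHS]aw0; apply: eq_bigr => i _.
    by rewrite !ffunE.
  have sab b : (\sum_i s i * a j i) *: m b = 0.
    rewrite scaler_suml.
    under eq_bigr => i _ do rewrite mulrC -scalerA sm scaler_sumr.
    rewrite exchange_big big1 //= => t _.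
    have swap i : a j i *: ((d t * r t i) *: m b) = d t *: (a j i *: (r t i *: m b)).
      by rewrite !scalerA; congr (_ *: _); ring.
    under eq_bigr => i _ do rewrite swap.
    by rewrite -scaler_sumr awb scaler0.
  move=> u; rewrite [u]cE /= scaler_sumr big1 // => b _.
  by rewrite scalerA mulrC -scalerA sab scaler0.
exists l', (fun j u => \sum_i c u i * a j i), y; split=> [u|j b u v].
  rewrite {1}[u]cE; under eq_bigr => i _ do rewrite my scaler_sumr.
  rewrite exchange_big; apply: eq_bigr => j _ /=.
  by rewrite scaler_suml; apply: eq_bigr => i _; rewrite scalerA.
(* The defect of linearity of the coordinates is itself a relation, so [aann] applies. *)
pose s i := c (b *: u + v) i - (b * c u i + c v i).
rewrite (_ : _ - _ = \sum_i s i * a j i); last first.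
  rewrite /s; under [RHS]eq_bigr => i _ do rewrite mulrBl mulrDl -mulrA.
  by rewrite sumrB big_split /= mulr_sumr.
apply: aann; rewrite /rel /s.
under eq_bigr => i _ do rewrite scalerBl scalerDl -scalerA.
by rewrite sumrB big_split /= -scaler_sumr -!cE subrr.
Qed.

(** * Strongly prime submodules *)

Lemma colon_cyclicP P x s : submodule P -> colon_cyclic P x s ->
  forall u, exists c, P (s *: u - c *: x).
Proof.
move=> Ps sP u; have [y Py [c _ e]] := sP u; exists c.
by rewrite -e addrK.
Qed.

Lemma strongly_prime_witness P x y : strongly_prime P -> ~ P x -> ~ P y ->
  exists2 s, colon_cyclic P x s & ~ P (s *: y).
Proof.
move=> [Ps PT PP] nPx nPy; apply: contrapT => no.
case: (PP x y) => // _ [s Is <-]; apply: contrapT => nPs; apply: no.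
by exists s.
Qed.

(** Some [s] maps [M] into [P + Ry] with [s *: y] outside [P], and [r * s] maps [M] into [P]. If
    [r *: m] were outside [P], some [t] would map [M] into [P + R(r m)] with [t *: (s *: y)] outside
    [P]; but modulo [P] this is a multiple of [(r * s) *: m]. *)
Lemma strongly_prime_torsion_free P r y : strongly_prime P ->
  P (r *: y) -> ~ P y -> colon P r.
Proof.
move=> Pp Pry nPy m; have [Ps PT _] := Pp; apply: contrapT => nPrm.
have [s Is nPsy] := strongly_prime_witness Pp nPy nPy.
have Prs u : P ((r * s) *: u).
  have [c Pc] := colon_cyclicP Ps Is u.
  rewrite -scalerA -(subrK (c *: y) (s *: u)) scalerDr.
  apply: submoduleD => //; first exact: submoduleZ.
  by rewrite scalerA mulrC -scalerA; exact: submoduleZ.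
have [t It nPt] := strongly_prime_witness Pp nPrm nPsy.
have [c Pc] := colon_cyclicP Ps It y.
apply: nPt; rewrite scalerA mulrC -scalerA -(subrK (c *: (r *: m)) (t *: y)).
rewrite scalerDr; apply: submoduleD => //; first exact: submoduleZ.
rewrite !scalerA (_ : s * (c * r) = c * (r * s)); last ring.
by rewrite -scalerA; exact: submoduleZ.
Qed.

Lemma strongly_prime_colon P : strongly_prime P -> prime_ideal (colon P).
Proof.
move=> Pp; have [Ps PT _] := Pp; split=> [|P1|a b Pab]; first exact: ideal_colon.
  by apply: PT; apply/seteqP; split=> // u _; rewrite -[u]scale1r; exact: P1.
case: (pselect (colon P a)) => [|/existsNP[u nPau]]; [by left|right].
by apply: (strongly_prime_torsion_free Pp _ nPau); rewrite scalerA mulrC.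
Qed.

Lemma colon_subset N L : N `<=` L -> colon N `<=` colon L.
Proof. by move=> NL r Nr m; exact/NL/Nr. Qed.

(** For [x] in [P] outside [L], some [s] maps [M] into [L + Rx], hence into [P], while [s *: x] is
    not in [L]. *)
Lemma strongly_prime_colon_proper L P : strongly_prime L -> strongly_prime P ->
  L `<` P -> colon L `<` colon P.
Proof.
move=> Lp Pp [LP nPL]; have [Ps _ _] := Pp; have [Ls _ _] := Lp.
split; first exact: colon_subset.
move=> cPL; apply: nPL => x Px; apply: contrapT => nLx.
have [s Is nLs] := strongly_prime_witness Lp nLx nLx.
apply/nLs/cPL => u; have [c Lc] := colon_cyclicP Ls Is u.
rewrite -(subrK (c *: x) (s *: u)).
by apply: submoduleD (LP _ Lc) _; last exact: submoduleZ.
Qed.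

(** For the maximal [P], each [x] outside [P] has some [s] outside [p] mapping [M] into [P + Rx].
    Were [P] not strongly prime, the product of two such scalars would lie in [colon P], hence in
    [p]. *)
Lemma exists_strongly_prime_over N p : noetherian M -> submodule N ->
    prime_ideal p -> colon N `<=` p ->
  exists P, [/\ strongly_prime P, N `<=` P & colon P `<=` p].
Proof.
move=> noethM Nsub pP cNp; have [pid p1 pM] := pP.
have [||P [Psub NP cPp] Pmax] := @acc_max _ (@submodule R M)
  (fun L => [/\ submodule L, N `<=` L & colon L `<=` p]) noethM.
- by move=> L [].
- by exists N; split.
have esc x : ~ P x -> exists2 s, colon_cyclic P x s & ~ p s.
  move=> nPx; apply: contrapT => no; apply: nPx; apply: (Pmax (add_cyclic P x)).
  - split.
    + apply/submoduleP; split.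
        by exists 0; [exact: submodule0|exists 0 => //; rewrite scale0r addr0].
      move=> a _ _ [u Pu [c _ <-]] [v Pv [d _ <-]]; exists (a *: u + v).
        by apply: submoduleD => //; exact: submoduleZ.
      by exists (a * c + d) => //; rewrite scalerDr scalerDl scalerA addrACA.
    + by move=> u /NP Pu; exists u => //; exists 0 => //; rewrite scale0r addr0.
    + by move=> s Is; apply: contrapT => nps; apply: no; exists s.
  - by move=> u Pu; exists u => //; exists 0 => //; rewrite scale0r addr0.
  - by exists 0; [exact: submodule0|exists 1 => //; rewrite scale1r add0r].
exists P; split=> //; split=> // [PT|x y IP].
  by apply: p1; apply: cPp => m; rewrite PT.
apply: contrapT => /not_orP[nPx nPy].
have [s Is nps] := esc x nPx; have [t It npt] := esc y nPy.
apply: (primeM pP nps npt); apply: cPp => u.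
have [c Pc] := colon_cyclicP Psub It u.
rewrite -scalerA -(subrK (c *: y) (t *: u)) scalerDr.
apply: submoduleD => //; first exact: submoduleZ.
rewrite scalerA mulrC -scalerA; apply: submoduleZ => //.
by apply: IP; exists s.
Qed.

(** With [s] mapping [M] into [P + Re], the coefficient [c] in [s u = c e] modulo [P] is unique only
    modulo [colon P]; choosing it on the [y j] and extending by the dual basis gives linearity
    modulo [ann M]. *)
Lemma strongly_prime_functional P : noetherian M -> flat M -> strongly_prime P ->
  exists phi e, [/\ linear_mod_ann phi, forall u, P u -> colon P (phi u) &
    ~ colon P (phi e)].
Proof.
move=> noethM flatM Pp; have [Ps PT _] := Pp.
have [l [f [y [yE fL]]]] := flat_dual_basis noethM flatM.
have [e nPe] : exists e, ~ P e.
  by apply/existsNP => allP; apply: PT; apply/seteqP; split.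
have [s Is nPse] := strongly_prime_witness Pp nPe nPe.
have [lam lamP] := choice (fun j => colon_cyclicP Ps Is (y j)).
pose phi u := \sum_j lam j * f j u.
have phiE u : P (s *: u - phi u *: e).
  rewrite {1}[u]yE scaler_sumr scaler_suml -sumrB.
  apply: submodule_sum => // j.
  rewrite (_ : _ - _ = f j u *: (s *: y j - lam j *: e)); first exact: submoduleZ.
  by rewrite scalerBr !scalerA mulrC [lam j * _]mulrC.
exists phi, e; split.
- move=> a u v; rewrite (_ : _ - _ =
    \sum_j lam j * (f j (a *: u + v) - (a * f j u + f j v))); last first.
    rewrite /phi mulr_sumr -big_split -sumrB; apply: eq_bigr => j _ /=; ring.
  have annid := ideal_colon submodule_0.
  apply: (big_ind (colon [set 0 : M])) => [|r r'|j _]; first exact: ideal0.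
    exact: idealD.
  by apply: idealMl (fL _ _ _ _).
- move=> u Pu; apply: (strongly_prime_torsion_free Pp _ nPe).
  rewrite -[_ *: e](subKr (s *: u)); apply: submoduleB (phiE u) => //.
  exact: submoduleZ.
- move=> /(_ e) Pphi; apply: nPse.
  by rewrite -(subrK (phi e *: e) (s *: e)); exact: submoduleD.
Qed.

Lemma strongly_minimal_prime_bound N n (x : 'I_n -> M) :
    noetherian M -> flat M -> submodule N -> N <> [set: M] ->
    N = generated (range x) ->
  exists2 P, strongly_minimal_prime N P &
    forall h, chain_lengths P h -> (h <= n)%N.
Proof.
move=> noethM flatM Nsub NT genN.
have cNid : ideal (colon N) by exact: ideal_colon.
have annN L : submodule L -> colon [set 0 : M] `<=` colon L.
  by move=> Ls; apply: colon_subset => _ ->; exact: submodule0.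
have cN1 : ~ colon N 1.
  by move=> N1; apply: NT; apply/seteqP; split=> // u _; rewrite -[u]scale1r; exact: N1.
have accA := noetherian_acc_ideal noethM.
have [p pmin] := exists_minimal_prime accA cNid (annN _ Nsub) cN1.
have [pP cNp pminP] := pmin.
have [P [Pp NP cPp]] := exists_strongly_prime_over noethM Nsub pP cNp.
have pcP := pminP _ (strongly_prime_colon Pp) (colon_subset NP) cPp.
have ecP : colon P = p by apply/seteqP.
have [Psub _ _] := Pp.
exists P.
  split=> // -[L [Lp NL LP]].
  have [cLP ncPL] := strongly_prime_colon_proper Lp Pp LP.
  apply: ncPL; rewrite ecP; apply: pminP; first exact: strongly_prime_colon.
    exact: colon_subset.
  by rewrite -ecP.
move=> h [C [Cp Clt Ch]].
have [phi [e [phiL phiP nphie]]] := strongly_prime_functional noethM flatM Pp.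
rewrite -[n]card_ord cardE -(size_map (phi \o x)).
apply: (@krull_height _ _ accA _ (colon P) (fun i => colon (C i))) => //.
- by rewrite ecP.
- by apply: annN; case: (Cp 0%N (leq0n h)).
- move=> p' p'P annp' xp' p'P'; rewrite ecP; apply: pminP => //; last by rewrite -ecP.
  (* As [p'] contains [ann M] and the [phi (x i)], it contains [phi z] for all [z] in [N]. For [r]
     in [colon N] it thus contains [phi (r *: e)], hence [r * phi e], and so [r]. *)
  move=> r cNr; have [p'id p'1 p'M] := p'P.
  have phiN z : N z -> p' (phi z).
    rewrite genN; apply: (@smallest_sub _ _ _ [set u | p' (phi u)]).
      have p'0 : p' (phi 0).
        (* [phi 0] is only known to lie in [ann M]. *)
        have /annp' := phiL (-1) 0 0; rewrite scaler0 addr0.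
        by rewrite mulN1r addNr subr0.
      apply/submoduleP; split=> // a u v pu pv.
      rewrite /= -[X in p' X](subrK (a * phi u + phi v)).
      by apply: idealD => //; [exact: annp'|mem_ideal].
    move=> _ [i _ <-]; apply: xp'; apply: map_f (mem_enum _ i).
  have : p' (r * phi e).
    have -> : r * phi e =
        phi (r *: e + 0) - (phi (r *: e + 0) - (r * phi e + phi 0)) - phi 0.
      by ring.
    apply: idealB => //; last first.
      by apply: phiN; exact: submodule0.
    by apply: idealB => //; [rewrite addr0; exact: phiN|exact: annp'].
  by case/p'M => // /p'P'.
- move=> _ /mapP[i _ ->]; apply: phiP; apply: NP; rewrite genN.
  by apply: sub_gen_smallest; exists i.
- by move=> i ih; apply: strongly_prime_colon; exact: Cp.
- move=> i ih; apply: strongly_prime_colon_proper; last exact: Clt.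
    exact: Cp (ltnW ih).
  exact: Cp.
- by rewrite Ch.
Qed.

End StronglyPrimeSubmodules.

(** * Strong heights *)

(** Should no supremum be attained, the default [-oo] still satisfies the bound. *)
Lemma supremum_le (A : set (\bar int)) (b : \bar int) :
  (forall t, A t -> (t <= b)%E) -> (supremum -oo%E A <= b)%E.
Proof.
move=> Ab; rewrite /supremum; case: ifP => _; first exact: leNye.
by case: xgetP => [t _ [_ /(_ b)]|_]; [apply|exact: leNye].
Qed.

(** Ensures that [infimum] is a true lower bound and not its default [+oo]. With no integer lower
    bound it is [-oo]; with an integer lower bound but no integer member it is [+oo]; otherwise it
    is the least integer member. *)
Lemma infimums_neq0 (A : set (\bar int)) : infimums A !=set0.
Proof.
case: (pselect (exists z : int, lbound A z%:E)) => [[z Az]|nolb]; last first.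
  exists -oo%E; split=> [t _|[z Az|Az|_ //]]; first exact: leNye.
    by case: nolb; exists z.
  case: nolb; exists 0 => t /Az; exact/le_trans/leey.
case: (pselect (exists k : nat, A (z + k%:Z)%:E)) => [exk|nok]; last first.
  exists +oo%E; split=> [t At|t _]; last exact: leey.
  case: t At => [v Av|//|/Az //]; case: nok; exists `|v - z|%N.
  have := Az _ Av; rewrite lee_fin => zv.
  by rewrite gez0_abs ?subr_ge0 // subrKC.
have exk' : exists k : nat, `[< A (z + k%:Z)%:E >].
  by case: exk => k Ak; exists k; apply/asboolP.
case: (ex_minnP exk') => m /asboolP Am mmin.
exists (z + m%:Z)%:E; split=> [t At|t At]; last exact: At.
case: t At => [v Av|_|/Az //]; last exact: leey.
have := Az _ Av; rewrite !lee_fin => zv.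
have vE : z + `|v - z|%N%:Z = v by rewrite gez0_abs ?subr_ge0 // subrKC.
have : (m <= `|v - z|)%N by apply: mmin; apply/asboolP; rewrite vE.
by rewrite -[X in (_ <= X)%R]vE lerD2l lez_nat.
Qed.

Theorem theorem2p3 (R : comPzRingType) (M : lmodType R)
    (noethM : noetherian M) (flatM : flat M)
    (N : set M) (submodN : submodule N) (properN : N <> [set: M])
    (n : nat) (x : 'I_n -> M) (genN : N = generated (range x)) :
  (strong_height_sub N <= n%:Z%:E)%E.
Proof.
have [P Pmin hP] := strongly_minimal_prime_bound noethM flatM submodN properN genN.
apply: (@le_trans _ _ (strong_height P)).
  by apply: le_infimum_Nmem; [exact: infimums_neq0|exists P].
by apply: supremum_le => _ [h hh <-]; rewrite lee_fin lez_nat; exact: hP.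
Qed.
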